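(* Let $G$ be a connected graph of order $n$ in which each block is a clique of order $b$. Then $$W(G)=\frac{nb}{2}\,\sum_{i=1}^{n-1}\frac{1}{\mu_i},$$ where $\mu_1\geq \mu_2\geq \cdots \geq \mu_n=0$ are the Laplacian eigenvalues of $G$.
   Context: All graphs are finite, simple, undirected and loopless. The Wiener index $W(G)$ of a connected graph $G$ is the sum of the distances (lengths of shortest paths) over all unordered pairs of vertices of $G$. The Laplacian matrix of $G$ is $L=\Delta-A$, where $A$ is the adjacency matrix and $\Delta$ is the diagonal degree matrix; its eigenvalues (with multiplicity) are the Laplacian eigenvalues. A block of $G$ is a maximal 2-connected subgraph, with the usual convention that a bridge together with its two endpoints (a copy of $K_2$) counts as a block, so that for instance each block of a tree with at least two vertices is a clique of order $2$. *)

(* Defs.v *)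
From mathcomp Require Import all_boot all_order all_algebra.

Set Implicit Arguments.
Unset Strict Implicit.
Unset Printing Implicit Defensive.

Import Order.TTheory GRing.Theory Num.Theory.

Local Open Scope ring_scope.

Record sgraph := SGraph {
  vertex :> finType;
  adj : rel vertex;
  adj_sym : symmetric adj;
  adj_irr : irreflexive adj
}.

(* The graph with vertex set S and the edges of r having both ends in S is
   nonempty and any two of its vertices are joined by a walk. *)
Definition connected_on (V : finType) (S : {set V}) (r : rel V) : Prop :=
  S != set0 /\
  {in S &, forall x y,
     connect [rel u v | [&& u \in S, v \in S & r u v]] x y}.

Definition connected_graph (G : sgraph) : Prop :=
  connected_on [set: G] (@adj G).

Definition has_path (G : sgraph) (x y : G) (k : nat) : bool :=
  [exists p : k.-tuple G,
     [&& path (@adj G) x p, uniq (x :: p) & last x p == y]].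

(* A path has fewer than #|G| edges, so the search for the least length is
   exhaustive; the value is #|G| when x and y are not joined by a path. *)
Definition dist (G : sgraph) (x y : G) : nat :=
  find (has_path x y) (iota 0 #|G|).

(* Each unordered pair is counted once, through the enumeration of G. *)
Definition wiener (G : sgraph) : nat :=
  (\sum_(x : G) \sum_(y : G | enum_rank x < enum_rank y) dist x y)%N.

Definition adjacency (R : nzRingType) (G : sgraph) : 'M[R]_#|G| :=
  \matrix_(i, j) (adj (enum_val i) (enum_val j))%:R.

Definition degree (G : sgraph) (x : G) : nat := #|[set y | adj x y]|.

Definition laplacian (R : nzRingType) (G : sgraph) : 'M[R]_#|G| :=
  diag_mx (\row_i (degree (enum_val i))%:R) - adjacency R G.

(* mu lists the eigenvalues of A, repeated according to (algebraic)
   multiplicity, in nonincreasing order; mu`_0 is the largest. *)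
Definition eigenvalue_list (R : realFieldType) (n : nat) (A : 'M[R]_n)
    (mu : seq R) : Prop :=
  sorted >=%R mu /\ char_poly A = \prod_(x <- mu) ('X - x%:P).

(* Subgraphs need not be induced. *)
Record subgraph (G : sgraph) := Subgraph {
  sub_verts : {set G};
  sub_adj : rel G;
  sub_adj_sym : symmetric sub_adj;
  sub_adjP : forall x y, sub_adj x y ->
    [/\ adj x y, x \in sub_verts & y \in sub_verts]
}.

Definition subgraph_le (G : sgraph) (H K : subgraph G) : Prop :=
  sub_verts H \subset sub_verts K /\ subrel (sub_adj H) (sub_adj K).

Definition two_connected (G : sgraph) (H : subgraph G) : Prop :=
  (2 < #|sub_verts H|)%N /\
  forall X : {set G}, (#|X| < 2)%N ->
    connected_on (sub_verts H :\: X) (sub_adj H).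

Definition maximal_two_connected (G : sgraph) (H : subgraph G) : Prop :=
  two_connected H /\
  forall K : subgraph G, two_connected K -> subgraph_le H K -> subgraph_le K H.

(* An edge is a bridge if deleting it separates its ends. *)
Definition bridge (G : sgraph) (x y : G) : bool :=
  adj x y &&
  ~~ connect [rel u v | adj u v && ([set u; v] != [set x; y])] x y.

Definition bridge_subgraph (G : sgraph) (H : subgraph G) : Prop :=
  exists x y : G,
    [/\ bridge x y, sub_verts H = [set x; y] & sub_adj H x y].

Definition block (G : sgraph) (H : subgraph G) : Prop :=
  maximal_two_connected H \/ bridge_subgraph H.

Definition clique_of_order (G : sgraph) (b : nat) (H : subgraph G) : Prop :=
  #|sub_verts H| = b /\
  {in sub_verts H &, forall x y, x != y -> sub_adj H x y}.

(* Main.v *)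
Require Import Defs.
From mathcomp Require Import all_boot all_order all_algebra.
From mathcomp Require Import ring zify.

(** In a connected graph whose blocks are cliques of order [b], the distance
    is [b / 2] times the effective resistance between the two vertices, and the
    sum of all effective resistances is [n] times the sum of the inverses of the
    nonzero Laplacian eigenvalues. The proof follows this idea without
    mentioning resistances, through a single matrix identity
      [L D L = - b L],
    where [D] is the distance matrix and [L] the Laplacian.

    The identity comes from a count of neighbours. Fix [x != y]. Every cycle
    lies in a block, hence spans a clique, so two neighbours of [x] that can be
    joined without passing through [x] are adjacent. It follows that one
    neighbour [z] of [x] is closer to [y] ([closer_unique]), that those at the
    same distance are the common neighbours of [x] and [z]
    ([equidistant_common]), and that there are [b - 2] of these
    ([card_common]). Hence the sum of [d(x, y) - d(w, y)] over the neighbours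
    [w] of [x] is [b - degree x] when [x != y] and [- degree x] when [x = y]: the
    matrix [L D + b I] has constant rows, and multiplying by [L] on the right
    gives the identity ([laplacian_dist]).

    To pass to eigenvalues, let [J] be the all-ones matrix. As the graph is
    connected, [M = L + J / n] is invertible, and its eigenvalues are [1] and
    the nonzero eigenvalues of [L]; so the trace of [M^-1] is one plus the sum
    in the theorem ([trace_inv_shifted_laplacian]). Multiplying the identity by
    [M^-1] on both sides and taking traces expresses the sum of all entries of
    [D], which is twice the Wiener index, by that trace
    ([sum_entries_of_sandwich]). *)

Set Implicit Arguments.
Unset Strict Implicit.
Unset Printing Implicit Defensive.

Import Order.TTheory GRing.Theory Num.Theory.

Local Open Scope ring_scope.

(** * Two-connected vertex sets and blocks *)

Section BlockCliques.

Variable G : sgraph.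
Implicit Types (x y z w : G) (A : {set G}).

Fact induced_adj_sym A : symmetric [rel u v : G | [&& u \in A, v \in A & adj u v]].
Proof. by move=> u v /=; rewrite adj_sym; case: (u \in A); rewrite ?andbF. Qed.

Fact induced_adjP A u v : [&& u \in A, v \in A & adj u v] ->
  [/\ adj u v, u \in A & v \in A].
Proof. by case/and3P. Qed.

Definition induced A : subgraph G :=
  Subgraph (@induced_adj_sym A) (@induced_adjP A).

Definition connected_set A : bool :=
  (A != set0) && [forall x in A, forall y in A, connect (sub_adj (induced A)) x y].

(** Boolean, so that a maximal two-connected vertex set exists constructively. *)
Definition two_connected_set A : bool :=
  (2 < #|A|)%N && [forall X : {set G}, (#|X| < 2)%N ==> connected_set (A :\: X)].

Lemma connected_setP A (r : rel G) :
  (forall u v, u \in A -> v \in A -> r u v = adj u v) ->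
  connected_set A -> connected_on A r.
Proof.
move=> rE /andP[A0 /'forall_in_'forall_in_idP conn]; split=> // x y xA yA.
rewrite (@eq_connect _ _ (sub_adj (induced A))) ?conn // => u v /=.
by case uA: (u \in A); case vA: (v \in A); rewrite //= rE.
Qed.

Lemma connected_set_root A r : r \in A ->
  (forall u, u \in A -> connect (sub_adj (induced A)) r u) -> connected_set A.
Proof.
move=> rA conn; apply/andP; split; first by apply/set0Pn; exists r.
apply/'forall_in_'forall_in_idP=> x xA y yA; apply: (@connect_trans _ _ r); last exact: conn.
by rewrite (sym_connect_sym (@induced_adj_sym A)) conn.
Qed.

Lemma two_connected_induced A :
  two_connected_set A -> two_connected (induced A).
Proof.
case/andP=> A2 /'forall_implyP conn; split=> // X /conn; apply: connected_setP.
by move=> u v /=; rewrite !inE => /andP[_ ->] /andP[_ ->].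
Qed.

Lemma two_connected_verts (K : subgraph G) :
  two_connected K -> two_connected_set (sub_verts K).
Proof.
case=> K2 conn; apply/andP; split=> //; apply/'forall_implyP=> X /conn [A0 kc].
rewrite /connected_set A0; apply/'forall_in_'forall_in_idP=> x xA y yA.
move: (kc x y xA yA); apply: connect_sub => u v /and3P[uA vA /sub_adjP[uv _ _]].
by apply: connect1; rewrite /= uA vA.
Qed.

(** Adding edges preserves two-connectedness, so maximality can be tested on
    vertex sets: a vertex set maximal for this property induces a maximal
    two-connected subgraph. *)
Lemma block_of_two_connected_set A : two_connected_set A ->
  exists2 B : {set G}, A \subset B & block (induced B).
Proof.
case/maxset_exists=> B /maxsetP[B2 Bmax] AB; exists B => //; left.
split=> [|K /two_connected_verts K2 [/= BK _]]; first exact: two_connected_induced.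
have eKB := Bmax _ K2 BK; split=> [|u v /sub_adjP[uv uK vK]] /=; first by rewrite eKB.
by rewrite -eKB uK vK.
Qed.

Lemma connect_path_in A a p u : path (@adj G) a p ->
  {subset a :: p <= A} -> u \in a :: p -> connect (sub_adj (induced A)) a u.
Proof.
elim: p a => [|c p IH] a /=; first by move=> _ _; rewrite inE => /eqP->.
case/andP=> ac cp sA; rewrite inE => /predU1P[->//|up].
have cA : {subset c :: p <= A} by move=> t tp; apply: sA; rewrite inE tp orbT.
apply: connect_trans (IH c cp cA up); apply: connect1.
by rewrite /= sA ?mem_head // cA ?mem_head.
Qed.

(** Deleting at most one vertex from a simple path cuts it into at most two
    pieces, so every surviving vertex stays joined to one of the two ends. The
    far end is needed only when the deleted vertex lies on the path, which is
    recorded in the second alternative. *)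
Lemma path_minus_point A (X : {set G}) w p u :
  {in X &, forall s t, s = t} -> path (@adj G) w p -> uniq (w :: p) ->
  {subset w :: p <= A} -> u \in w :: p -> u \notin X ->
  let e := sub_adj (induced (A :\: X)) in
  w \notin X /\ connect e w u \/
  [/\ last w p \notin X, connect e (last w p) u & exists2 t, t \in X & t \in w :: p].
Proof.
move=> X1 wp Up sA up uX e.
case/splitPl: p / up wp Up sA => p1 p2 lp1.
rewrite cat_path last_cat lp1 -cat_cons => /andP[wp1 up2] Up sA.
have [/existsP[t /andP[tp1 tX]]|noX] := boolP [exists t, (t \in w :: p1) && (t \in X)].
  have p2X s : s \in u :: p2 -> s \notin X.
    rewrite inE => /predU1P[->//|sp2]; apply: contraL Up => sX.
    rewrite cat_uniq; apply/negP=> /and3P[_ /hasPn/(_ s sp2)/negP[]].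
    by rewrite (X1 s t).
  right; split; first exact/p2X/mem_last.
    rewrite (sym_connect_sym (@induced_adj_sym _)).
    apply: (connect_path_in up2) (mem_last _ _) => s sp.
    rewrite !inE p2X // sA // mem_cat.
    by move: sp; rewrite inE => /predU1P[->|->]; rewrite ?orbT // -lp1 mem_last.
  by exists t => //; rewrite mem_cat tp1.
left; have p1X s : s \in w :: p1 -> s \notin X.
  by move=> sp; apply: contra noX => sX; apply/existsP; exists s; rewrite sp.
split; first by apply: p1X; rewrite mem_head.
apply: (connect_path_in wp1); last by rewrite -lp1 mem_last.
by move=> s sp; rewrite !inE p1X // sA // mem_cat sp.
Qed.

(** The cycle is given as a path [w :: p] closed by [x], both ends being
    adjacent to [x]. What survives on the path is tied to an end of the path,
    and both ends are tied to [x]; when [x] itself is deleted the path is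
    intact. *)
Lemma cycle_two_connected x w p : adj x w -> adj x (last w p) ->
  path (@adj G) w p -> uniq (x :: w :: p) -> p != [::] ->
  two_connected_set [set u in x :: w :: p].
Proof.
move=> xw xz wp Up p0; set A := [set u in _].
apply/andP; split; first by rewrite cardsE (card_uniqP Up); case: p p0 {wp Up A xz}.
apply/'forall_implyP=> X X1.
have Xeq : {in X &, forall s t, s = t}.
  move=> s t sX tX; apply/eqP; apply: contraTT X1 => st.
  by rewrite -leqNgt (cardsD1 s) (cardsD1 t) sX !inE eq_sym st tX.
have [xNp Uwp] := andP Up.
have sA : {subset w :: p <= A} by move=> t tp; rewrite inE in_cons tp orbT.
have ends u := path_minus_point Xeq wp Uwp sA (u := u).
have [xX|xX] := boolP (x \in X).
  have wC : w \in A :\: X.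
    rewrite !inE eqxx orbT andbT; apply: contra xNp => wX.
    by rewrite (Xeq x w) ?mem_head.
  apply: (connected_set_root wC) => u; rewrite !inE => /andP[uX /predU1P[ux|up]].
    by rewrite ux xX in uX.
  case: (ends u up uX) => [[]//|[_ _ [t tX tp]]].
  by rewrite (Xeq x t) ?tp in xNp.
have xC : x \in A :\: X by rewrite !inE xX eqxx.
have xconn t : adj x t -> t \in w :: p -> t \notin X ->
    connect (sub_adj (induced (A :\: X))) x t.
  by move=> xt tp tX; apply: connect1; rewrite /= xC xt !inE tX -in_cons tp orbT.
apply: (connected_set_root xC) => u; rewrite !inE => /andP[uX /predU1P[->//|up]].
case: (ends u up uX) => [[wX]|[lX + _]]; apply: connect_trans; apply: xconn => //.
  by rewrite mem_head.
exact: mem_last.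
Qed.

(** * Distances in a connected graph *)

Hypothesis G_connected : connected_graph G.

Lemma dist_le_path x p : path (@adj G) x p -> (dist x (last x p) <= size p)%N.
Proof.
case/shortenP=> q xq Uq qp; apply: (@leq_trans (size q)); last first.
  by apply: uniq_leq_size => //; case/andP: Uq.
have hp : has_path x (last x q) (size q).
  by apply/existsP; exists (in_tuple q); rewrite xq Uq eqxx.
have lq : (size q < #|G|)%N by have := max_card [in x :: q]; rewrite (card_uniqP Uq).
rewrite leqNgt; apply/negP=> /(before_find 0%N).
by rewrite nth_iota // add0n hp.
Qed.

Lemma dist_path x y : exists p,
  [/\ path (@adj G) x p, last x p = y & size p = dist x y].
Proof.
case: G_connected => _ /(_ x y (in_setT _) (in_setT _)) /connectP[p xp ->].
have {xp} : path (@adj G) x p by apply: sub_path xp => u v /and3P[].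
case/shortenP=> q xq Uq _.
have lq : (size q < #|G|)%N by have := max_card [in x :: q]; rewrite (card_uniqP Uq).
have : has (has_path x (last x q)) (iota 0 #|G|).
  apply/hasP; exists (size q); first by rewrite mem_iota.
  by apply/existsP; exists (in_tuple q); rewrite xq Uq eqxx.
move=> h; move: (nth_find 0%N h); rewrite nth_iota -?has_find // ?add0n; last first.
  by move: h; rewrite has_find size_iota.
by case/existsP=> t /and3P[xt _ /eqP lt]; exists t; rewrite lt size_tuple.
Qed.

Lemma dist_xx x : dist x x = 0%N.
Proof. by apply/eqP; rewrite -leqn0; apply: (@dist_le_path x [::]). Qed.

Lemma dist_gt0 x y : x != y -> (0 < dist x y)%N.
Proof. by case: (dist_path x y) => [[|c p] [/= _ <- <-]]; rewrite ?eqxx. Qed.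

Lemma dist_sym x y : dist x y = dist y x.
Proof.
suff le (a c : G) : (dist a c <= dist c a)%N by apply/eqP; rewrite eqn_leq !le.
have [p [cp la <-]] := dist_path c a.
have ap : path (@adj G) a (rev (belast c p)).
  by rewrite -la rev_path; apply: sub_path cp => u v /=; rewrite adj_sym.
have := dist_le_path ap; rewrite size_rev size_belast; congr (dist _ _ <= _)%N.
case: p {cp ap} la => [//|d p] _ /=; by rewrite rev_cons last_rcons.
Qed.

Lemma dist_adj x y z : adj x z -> (dist x y <= (dist z y).+1)%N.
Proof.
have [p [zp <- <-]] := dist_path z y => xz.
by apply: (@dist_le_path x (z :: p)); rewrite /= xz.
Qed.

(** The second vertex of a shortest path. *)
Lemma closer_neighbour x y : x != y ->
  exists2 z, adj x z & dist x y = (dist z y).+1.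
Proof.
case: (dist_path x y) => [[|z p] [/=]]; first by move=> _ ->; rewrite eqxx.
case/andP=> xz zp ly sp _; exists z => //; apply/eqP.
by rewrite eqn_leq dist_adj //= -sp ltnS -ly dist_le_path.
Qed.

(** Adjacency in [G - x]. *)
Definition del x : rel G := sub_adj (induced [set~ x]).

(** Along a shortest path from [w] to [y] every vertex after [w] is strictly
    closer to [y] than [x] is, hence differs from [x]. *)
Lemma connect_avoiding x y w : w != x -> (dist w y <= dist x y)%N ->
  connect (del x) w y.
Proof.
have [n] := ubnP (dist w y); elim: n w => // n IH w; rewrite ltnS => dn wx dwx.
have [->//|wy] := eqVneq w y.
have [z wz dz] := closer_neighbour wy.
have zx : z != x by apply: contraTneq dwx => <-; rewrite dz ltnn.
apply: connect_trans (IH z _ zx _); [|lia..].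
by apply: connect1; rewrite /del /= !inE wx zx.
Qed.

(** * Graphs whose blocks are cliques of order b *)

Variable b : nat.
Hypothesis G_blocks : forall H : subgraph G, block H -> clique_of_order b H.

Lemma sub_clique A : two_connected_set A -> exists B : {set G},
  [/\ A \subset B, #|B| = b & {in B &, forall x y, x != y -> adj x y}].
Proof.
case/block_of_two_connected_set=> B AB /G_blocks[/= Bb Bc]; exists B; split=> //.
by move=> u v uB vB /(Bc u v uB vB) /and3P[].
Qed.

(** A walk from [w] to [z] that avoids [x] closes, through [x], into a cycle; a
    cycle lies in a block, and blocks are cliques. Every later use of cycles goes through this lemma. *)
Lemma neighbours_joined_adj x w z : adj x w -> adj x z -> w != z ->
  connect (del x) w z -> adj w z.
Proof.
move=> xw xz wz /connectP[p]; case/shortenP=> q wq Uq _ zq; subst z.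
have xq : x \notin w :: q.
  have xw' : x != w by apply: contraTneq xw => <-; rewrite adj_irr.
  rewrite inE negb_or xw' /=; apply/negP=> xq.
  elim: q w wq xq {xw xz wz Uq xw'} => //= c q IH w /andP[/and3P[_ cx _] cq].
  by rewrite inE => /predU1P[xc|]; [rewrite xc !inE eqxx in cx|apply: IH cq].
have wq' : path (@adj G) w q by apply: sub_path wq => u v /and3P[].
have q0 : q != [::] by apply: contraNneq wz => ->.
have Up : uniq [:: x, w & q] by rewrite cons_uniq xq.
have [B [/subsetP AB _ Bc]] := sub_clique (cycle_two_connected xw xz wq' Up q0).
by apply: Bc => //; apply: AB; rewrite inE in_cons ?mem_head ?mem_last ?orbT.
Qed.

Definition common x z : {set G} := [set w | adj x w && adj z w].

Lemma adj_neq x z : adj x z -> x != z.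
Proof. by apply: contraTneq => ->; rewrite adj_irr. Qed.

(** [x] and [z] are both adjacent to all the other vertices of the set, so
    either of them that survives the deletion serves as a hub. *)
Lemma edge_two_connected x z : adj x z -> common x z != set0 ->
  two_connected_set ([set x; z] :|: common x z).
Proof.
move=> xz /set0Pn[c]; rewrite inE => /andP[xc zc]; set S := _ :|: _.
have SE u : u \in S = [|| u == x, u == z | adj x u && adj z u].
  by rewrite !inE -orbA.
apply/andP; split.
  have /subset_leq_card : [set x; z; c] \subset S.
    apply/subsetP=> u; rewrite SE !inE -orbA => /or3P[]/eqP->; rewrite ?eqxx ?orbT //.
    by rewrite xc zc !orbT.
  apply: leq_trans; rewrite setUC cardsU1 cards2 !inE (adj_neq xz).
  by rewrite ![c == _]eq_sym (negPf (adj_neq xc)) (negPf (adj_neq zc)).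
apply/'forall_implyP=> X X1.
have root r : r \in S -> r \notin X -> (forall u, u \in S -> u != r -> u \notin X -> adj r u) ->
    connected_set (S :\: X).
  move=> rS rX radj; have rC : r \in S :\: X by rewrite inE rX.
  apply: (connected_set_root rC) => u; rewrite inE => /andP[uX uS].
  have [->//|ur] := eqVneq u r; apply: connect1.
  by rewrite /= rC inE uX uS radj.
have zx : adj z x by rewrite adj_sym.
have [xX|xX] := boolP (x \in X).
  apply: (root z); first by rewrite SE eqxx orbT.
    apply: contraTN X1 => zX; rewrite -leqNgt (cardsD1 x) (cardsD1 z) xX !inE zX.
    by rewrite eq_sym (adj_neq xz).
  by move=> u; rewrite SE => /or3P[/eqP->|/eqP->|/andP[]//]; rewrite ?eqxx.
apply: (root x); rewrite ?SE ?eqxx //.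
by move=> u; rewrite SE => /or3P[/eqP->|/eqP->|/andP[]//]; rewrite ?eqxx.
Qed.

(** An edge with its common neighbours is the block of that edge. When there
    is a common neighbour the set is two-connected, so it sits in a block, and
    that block, being a clique, contains nothing else. When there is none the
    edge is a bridge, since a cycle through it would produce one by
    [neighbours_joined_adj]. *)
Lemma edge_clique x z : adj x z ->
  #|[set x; z] :|: common x z| = b /\
  {in common x z &, forall u v, u != v -> adj u v}.
Proof.
move=> xz; have [c0|c0] := eqVneq (common x z) set0; last first.
  have [B [SB Bb Bc]] := sub_clique (edge_two_connected xz c0).
  have [xB zB] : x \in B /\ z \in B.
    by split; apply: (subsetP SB); rewrite !inE eqxx ?orbT.
  split.
    rewrite -Bb; congr #|pred_of_set _|; apply/eqP; rewrite eqEsubset SB /=.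
    apply/subsetP=> u uB; rewrite !inE.
    have [//|ux] := eqVneq u x; have [//|uz] /= := eqVneq u z.
    by rewrite !Bc // eq_sym.
  by move=> u v uc vc; apply: Bc; apply: (subsetP SB); rewrite inE ?uc ?vc orbT.
split; last by move=> u v; rewrite c0 inE.
have xz_bridge : bridge x z.
  rewrite /bridge xz; apply/negP=> /connectP[p]; case/shortenP=> q xq Uq _.
  case: q xq Uq => [|u q] /=; first by move=> _ _ zx; rewrite zx adj_irr in xz.
  case/andP=> /andP[xu nxu] uq /andP[xNq Uq] lz.
  have uz : u != z by apply: contraNneq nxu => ->.
  have uz_adj : adj u z.
    apply: (neighbours_joined_adj xu xz uz); apply/connectP; exists q => //.
    apply: (@sub_in_path _ [in u :: q]) uq; last exact/allP.
    move=> s t sq tq /= /andP[st _]; rewrite /del /= !inE st andbT.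
    by apply/andP; split; apply: contraNneq xNq => <-.
  by move/setP/(_ u): c0; rewrite !inE xu adj_sym uz_adj.
have /G_blocks[/= + _] : block (induced [set x; z]).
  by right; exists x, z; split=> //=; rewrite !inE !eqxx orbT.
by rewrite c0 setU0.
Qed.

Lemma card_common x z : adj x z -> b = (#|common x z|).+2.
Proof.
move=> xz; have [<- _] := edge_clique xz; rewrite cardsU cards2 (adj_neq xz).
suff -> : [set x; z] :&: common x z = set0 by rewrite cards0 subn0.
apply/setP=> u; rewrite !inE; case: eqVneq => [->|_] /=; first by rewrite adj_irr.
by case: eqVneq => [->|//]; rewrite adj_irr andbF.
Qed.

(** [w] and [z] are joined through [y], by shortest paths that avoid [x]. *)
Lemma not_farther_adj x y z w : adj x z -> adj x w -> w != z ->
  (dist z y <= dist x y)%N -> (dist w y <= dist x y)%N -> adj w z.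
Proof.
move=> xz xw wz zy wy; apply: (neighbours_joined_adj xw xz wz).
have zx : z != x by rewrite eq_sym adj_neq.
have wx : w != x by rewrite eq_sym adj_neq.
apply: (@connect_trans _ _ y); first exact: connect_avoiding.
by rewrite (sym_connect_sym (@induced_adj_sym _)) connect_avoiding.
Qed.

(** Two such neighbours [w] and [z] would be adjacent and equidistant from [y].
    A neighbour [t] of [w] still closer to [y] would then be adjacent to [z];
    so [x] and [t] are both common neighbours of [w] and [z], hence adjacent,
    although their distances to [y] differ by two. *)
Lemma closer_unique x y z w : adj x z -> adj x w ->
  dist x y = (dist z y).+1 -> dist x y = (dist w y).+1 -> w = z.
Proof.
move=> xz xw dz dw; apply/eqP; apply/negPn/negP=> wz.
have wz_adj : adj w z by apply: (@not_farther_adj x y); rewrite // ?dz ?dw //; lia.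
have wy : w != y.
  apply: contraNneq wz => wy; rewrite wy; apply: contra_eqT (dw) => yz.
  by have := dist_gt0 yz; rewrite dz wy dist_xx dist_sym; lia.
have [t wt dt] := closer_neighbour wy.
have tz : t != z by apply/eqP=> etz; rewrite etz in dt; lia.
have tz_adj : adj t z by apply: (@not_farther_adj w y) => //; lia.
have xt : x != t by apply/eqP=> ext; rewrite -ext in dt; lia.
have [_ /(_ x t)] := edge_clique wz_adj.
rewrite !inE ![adj _ x]adj_sym xz xw wt [adj z t]adj_sym tz_adj => /(_ isT isT xt) /(dist_adj y).
lia.
Qed.

(** Seen from [x], the vertex [y] lies beyond a single block, whose entry point
    is [z]; the neighbours of [x] at the same distance from [y] are the vertices
    of that block other than [x] and [z]. *)
Lemma equidistant_common x y z w : adj x z -> dist x y = (dist z y).+1 ->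
  adj x w -> (dist w y == dist x y) = (w \in common x z).
Proof.
move=> xz dz xw; rewrite inE xw /=; apply/eqP/idP=> [dw|zw].
  rewrite adj_sym (@not_farther_adj x y) //; try lia.
  by apply/eqP=> ewz; rewrite ewz in dw; lia.
have dwz : (dist w y <= (dist z y).+1)%N by apply: dist_adj; rewrite adj_sym.
have dxw := dist_adj y xw.
have [//|nd] := eqVneq (dist w y) (dist x y).
have ezw : w = z by apply: (closer_unique xz xw dz); lia.
by rewrite ezw adj_irr in zw.
Qed.

End BlockCliques.

(** * Traces of inverses and rank-one updates *)

Section LinearAlgebra.

Variable F : numFieldType.

Lemma poly_eq_nonzero (p q : {poly F}) :
  (forall x, x != 0 -> p.[x] = q.[x]) -> p = q.
Proof.
move=> pq; apply/eqP; rewrite -subr_eq0; apply/eqP.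
apply: (@roots_geq_poly_eq0 _ _ [seq k.+1%:R | k <- iota 0 (size (p - q))]).
- apply/allP=> _ /mapP[k _ ->]; rewrite rootE hornerD hornerN pq ?subrr //.
  by rewrite pnatr_eq0.
- rewrite map_inj_uniq ?iota_uniq // => i j /eqP.
  by rewrite eqr_nat => /eqP[].
- by rewrite size_map size_iota.
Qed.

Lemma horner_char_poly n (A : 'M[F]_n) x : (char_poly A).[x] = \det (x%:M - A).
Proof.
rewrite -horner_evalE -det_map_mx; congr (\det _).
apply/matrixP=> i j; rewrite !mxE /= /horner_eval !hornerE hornerMn hornerX.
by [].
Qed.

(** Both sides are the determinant of the bordered matrix with blocks
    [1, v, u, 1], eliminated from either corner. *)
Lemma det_rank1_update n (u : 'cV[F]_n) (v : 'rV[F]_n) :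
  \det (1%:M - u *m v) = 1 - (v *m u) 0 0.
Proof.
have EL : block_mx (1%:M : 'M_1) v u 1%:M
    = block_mx 1%:M 0 u 1%:M *m block_mx 1%:M v 0 (1%:M - u *m v).
  by rewrite mulmx_block !(mul1mx, mulmx1, mul0mx, mulmx0, addr0, subrKC).
have EU : block_mx (1%:M : 'M_1) v u 1%:M
    = block_mx 1%:M v 0 1%:M *m block_mx (1%:M - v *m u) 0 u 1%:M.
  by rewrite mulmx_block !(mul1mx, mulmx1, mul0mx, mulmx0, add0r, subrK).
have := congr1 determinant EU; rewrite EL !det_mulmx.
rewrite !det_lblock !det_ublock !det1 !mul1r !mulr1 => ->.
by rewrite det_mx11 !mxE.
Qed.

(** When [A u = 0] one has [(x - A)(x - u v) = x (x - A - u v)], so the update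
    only moves one zero eigenvalue to [v u]. *)
Lemma char_poly_rank1_update n (A : 'M[F]_n) (u : 'cV[F]_n) (v : 'rV[F]_n) :
  A *m u = 0 ->
  char_poly (A + u *m v) * 'X = char_poly A * ('X - ((v *m u) 0 0)%:P).
Proof.
move=> Au; apply: poly_eq_nonzero => x x0; rewrite !hornerE !horner_char_poly.
have E : (x%:M - A) *m (1%:M - x^-1 *: u *m v) = x%:M - (A + u *m v).
  rewrite mulmxBr mulmx1 mulmxA mulmxBl mul_scalar_mx scalerA divff // scale1r.
  by rewrite -scalemxAr Au scaler0 subr0 opprD addrA.
rewrite -E det_mulmx det_rank1_update -scalemxAr mxE -mulrA; congr (_ * _).
by field.
Qed.

(** For [x != 0] the value of [char_poly A^-1] at [x] is, up to constants,
    [x ^ n] times the value of [char_poly A] at [1 / x]; hence the eigenvalues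
    of the inverse are the inverses, and the trace is read off the subleading
    coefficient. *)
Lemma trace_invmx n (A : 'M[F]_n) (s : seq F) : A \in unitmx ->
  char_poly A = \prod_(a <- s) ('X - a%:P) -> \tr (invmx A) = \sum_(a <- s) a^-1.
Proof.
move=> uA pA; have ss : size s = n.
  by apply/eqP; rewrite -eqSS -(size_prod_XsubC s id) -pA size_char_poly.
have dA : \det A = \prod_(a <- s) a.
  have := horner_char_poly A 0; rewrite pA horner_prod raddf0 sub0r.
  rewrite (eq_bigr (fun a => -1 * a)) => [|a _]; last by rewrite !hornerE mulN1r.
  rewrite big_split big_const_seq /= count_predT iter_mulr_1 ss -scaleN1r detZ.
  by move=> e; apply: (mulfI _ (esym e)); rewrite expf_neq0 // oppr_eq0 oner_eq0.
have s0 a : a \in s -> a != 0.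
  move=> sa; apply: contraTneq uA => a0; rewrite unitmxE unitfE dA negbK.
  by rewrite (big_rem a) //= a0 mul0r.
case: n A uA pA ss dA => [|n] A uA pA ss dA.
  by rewrite (size0nil ss) big_nil /mxtrace big_ord0.
have pV : char_poly (invmx A) = \prod_(a <- map GRing.inv s) ('X - a%:P).
  apply: poly_eq_nonzero => x x0; rewrite big_map horner_prod horner_char_poly.
  have E : A *m (x%:M - invmx A) = - x *: (x^-1%:M - A).
    rewrite mulmxBr mulmxV // mul_mx_scalar scaleNr scalerBr opprB.
    by rewrite -[x *: _^-1%:M]mul_scalar_mx -scalar_mxM divff.
  apply: (@mulfI _ (\det A)); first by rewrite -unitfE -unitmxE.
  rewrite -det_mulmx E detZ -horner_char_poly pA horner_prod dA -ss.
  rewrite -iter_mulr_1 -(count_predT s) -big_const_seq -!big_split /=.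
  rewrite big_seq [RHS]big_seq; apply: eq_bigr => a /s0 a0; rewrite !hornerE.
  by field; rewrite a0.
have := char_poly_trace (invmx A) isT; rewrite pV.
have -> : n.+1.-1 = (size (map GRing.inv s)).-1 by rewrite size_map ss.
by rewrite coefPn_prod_XsubC ?size_map ?ss // big_map => /oppr_inj ->.
Qed.

Lemma const_mx1_sqr n :
  (const_mx 1 : 'M[F]_n) *m (const_mx 1 : 'M_n) = n%:R *: const_mx 1.
Proof.
apply/matrixP=> i j; rewrite !mxE (eq_bigr (fun=> 1)) => [|k _].
  by rewrite sumr_const card_ord mulr1.
by rewrite !mxE mulr1.
Qed.

(** With [N = M^-1] and [P = 1 - J / n] one has [N L = L N = P]. Multiplying the
    sandwich identity by [N] on both sides gives [P D P = - c (N - J / n)], and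
    since [D] has trace zero the trace of the left side is minus the sum of
    the entries of [D] divided by [n]. *)
Lemma sum_entries_of_sandwich n (c : F) (L D : 'M[F]_n) :
  let J := const_mx 1 in let M := L + n%:R^-1 *: J in
  (0 < n)%N -> M \in unitmx -> L *m J = 0 -> J *m L = 0 ->
  L *m D *m L = - c *: L -> \tr D = 0 ->
  \tr (D *m J) = n%:R * c * (\tr (invmx M) - 1).
Proof.
move=> J M n0 uM LJ JL LDL trD; set N := invmx M.
have nF : n%:R != 0 :> F by rewrite pnatr_eq0 -lt0n.
have JJ : J *m J = n%:R *: J by exact: const_mx1_sqr.
have trJ : \tr J = n%:R.
  rewrite /mxtrace (eq_bigr (fun=> 1)) => [|k _]; last by rewrite mxE.
  by rewrite sumr_const card_ord.
have MJ : M *m J = J by rewrite mulmxDl LJ add0r -scalemxAl JJ scalerA mulVf ?scale1r.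
have JM : J *m M = J by rewrite mulmxDr JL add0r -scalemxAr JJ scalerA mulVf ?scale1r.
have NJ : N *m J = J by rewrite -{1}MJ mulmxA mulVmx // mul1mx.
have JN : J *m N = J by rewrite -{1}JM -mulmxA mulmxV // mulmx1.
pose P := 1%:M - n%:R^-1 *: J.
have LE : L = M - n%:R^-1 *: J by rewrite addrK.
have NL : N *m L = P by rewrite LE mulmxBr mulVmx // -scalemxAr NJ.
have LN : L *m N = P by rewrite LE mulmxBl mulmxV // -scalemxAl JN.
have PDP : P *m D *m P = - c *: (N - n%:R^-1 *: J).
  rewrite -{1}NL -LN -!mulmxA (mulmxA L) (mulmxA (L *m D)) (mulmxA _ _ N) LDL.
  by rewrite -scalemxAr -scalemxAl -mulmxA LN mulmxBr mulmx1 -scalemxAr NJ.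
have := congr1 mxtrace PDP.
rewrite mulmxBr mulmx1 mulmxBl mul1mx -!scalemxAr -!scalemxAl mulmxBl -!scalemxAl.
rewrite !(linearB, linearZ) /= trD trJ [\tr (J *m D *m J)]mxtrace_mulC.
rewrite mulmxA JJ -scalemxAl linearZ /=.
rewrite (mxtrace_mulC J) => E.
have : - (\tr (D *m J) / n%:R) = - c * (\tr N - 1).
  by apply: etrans (etrans E _); field.
move/eqP; rewrite mulNr eqr_opp eq_sym => /eqP e; rewrite -mulrA e.
by field.
Qed.

End LinearAlgebra.

(** * The Laplacian and the distance matrix *)

Section Laplacian.

Variables (R : rcfType) (G : sgraph).
Local Notation L := (laplacian R G).

Lemma sum_ord_vertex (F : G -> R) :
  \sum_(i < #|G|) F (enum_val i) = \sum_x F x.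
Proof. by rewrite -big_enum_val. Qed.

Lemma natr_degree (x : G) : (degree x)%:R = \sum_y (adj x y)%:R :> R.
Proof.
rewrite /degree -sum1_card natr_sum big_mkcond; apply: eq_bigr => y _.
by rewrite inE; case: (adj x y).
Qed.

Lemma laplacianE i j : L i j =
  (degree (enum_val i))%:R * (i == j)%:R - (adj (enum_val i) (enum_val j))%:R.
Proof. by rewrite !mxE mulr_natr. Qed.

Lemma laplacian_mulE (p : nat) (A : 'M[R]_(#|G|, p)) i j : (L *m A) i j =
  \sum_k (adj (enum_val i) (enum_val k))%:R * (A i j - A k j).
Proof.
rewrite mxE (eq_bigr (fun k => (degree (enum_val i))%:R * (i == k)%:R * A k j
    - (adj (enum_val i) (enum_val k))%:R * A k j)) => [|k _]; last first.
  by rewrite laplacianE mulrBl.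
rewrite sumrB (bigD1 i) //= eqxx mulr1 big1 ?addr0 => [|k ki]; last first.
  by rewrite eq_sym (negPf ki) mulr0 mul0r.
rewrite natr_degree -sum_ord_vertex mulr_suml -sumrB.
by apply: eq_bigr => k _; rewrite mulrBr.
Qed.

Lemma laplacian_sym : L^T = L.
Proof.
apply/matrixP=> i j; rewrite mxE !laplacianE adj_sym eq_sym.
by case: eqVneq => [->|_]; rewrite ?mulr0.
Qed.

Lemma laplacian_const p : L *m (const_mx 1 : 'M_(_, p)) = 0.
Proof.
apply/matrixP=> i j; rewrite laplacian_mulE [RHS]mxE big1 // => k _.
by rewrite !mxE subrr mulr0.
Qed.

Lemma const_laplacian p : (const_mx 1 : 'M_(p, _)) *m L = 0.
Proof.
by apply: trmx_inj; rewrite trmx_mul laplacian_sym trmx_const laplacian_const trmx0.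
Qed.

(** The quadratic form is a sum over edges of squared differences; summing over
    ordered pairs counts each edge twice. *)
Lemma dirichlet_form (u : 'cV[R]_#|G|) :
  (u^T *m L *m u) 0 0 *+ 2 =
  \sum_i \sum_j (adj (enum_val i) (enum_val j))%:R * (u i 0 - u j 0) ^+ 2.
Proof.
have E : (u^T *m L *m u) 0 0 =
    \sum_i \sum_j (adj (enum_val i) (enum_val j))%:R * (u i 0 * (u i 0 - u j 0)).
  rewrite -mulmxA mxE; apply: eq_bigr => i _.
  rewrite laplacian_mulE mxE mulr_sumr; apply: eq_bigr => j _; ring.
rewrite mulr2n {2}E exchange_big /= E -big_split; apply: eq_bigr => i _ /=.
rewrite -big_split; apply: eq_bigr => j _ /=; rewrite adj_sym; ring.
Qed.

Lemma dirichlet_form_ge0 (u : 'cV[R]_#|G|) : 0 <= (u^T *m L *m u) 0 0.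
Proof.
rewrite -(@pmulrn_lge0 _ _ 2) // dirichlet_form.
apply: sumr_ge0 => i _; apply: sumr_ge0 => j _.
by rewrite mulr_ge0 ?ler0n ?sqr_ge0.
Qed.

Lemma laplacian_eigenvalue_ge0 a : root (char_poly L) a -> 0 <= a.
Proof.
rewrite -eigenvalue_root_char => /eigenvalueP[v vL v0].
have := dirichlet_form_ge0 v^T; rewrite trmxK vL -scalemxAl mxE.
have vv : (v *m v^T) 0 0 = \sum_i v 0 i ^+ 2.
  by rewrite mxE; apply: eq_bigr => i _; rewrite mxE expr2.
rewrite pmulr_lge0 // vv lt0r sumr_ge0 ?andbT => [|i _]; last exact: sqr_ge0.
apply: contraNneq v0 => /eqP.
rewrite psumr_eq0 => [/allP h|i _]; last exact: sqr_ge0.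
apply/eqP/rowP=> i; rewrite mxE; apply/eqP.
by rewrite -sqrf_eq0; apply: h; rewrite mem_index_enum.
Qed.

Hypothesis G_connected : connected_graph G.

Lemma order_gt0 : (0 < #|G|)%N.
Proof. by case: G_connected => /set0Pn[x _] _; apply/card_gt0P; exists x. Qed.

Lemma laplacian_ker_const (u : 'cV[R]_#|G|) : L *m u = 0 -> forall i j, u i 0 = u j 0.
Proof.
move=> Lu i j; have := dirichlet_form u; rewrite -mulmxA Lu mulmx0 mxE mul0rn.
move/esym/eqP; rewrite psumr_eq0 => [/allP h|k _]; last first.
  by apply: sumr_ge0 => l _; rewrite mulr_ge0 ?ler0n ?sqr_ge0.
pose f x := u (enum_rank x) 0.
have fE x y : adj x y -> f x = f y.
  move=> xy; have := h (enum_rank x) (mem_index_enum _).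
  rewrite psumr_eq0 => [/allP/(_ (enum_rank y) (mem_index_enum _))|k _]; last first.
    by rewrite mulr_ge0 ?ler0n ?sqr_ge0.
  by rewrite !enum_rankK xy mul1r sqrf_eq0 subr_eq0 => /eqP.
have fC x y : f x = f y.
  case: G_connected => _ /(_ x y (in_setT _) (in_setT _)) /connectP[p xp ->].
  by elim: p x xp => //= z p IH x /andP[/and3P[_ _ /fE->] /IH].
by have := fC (enum_val i) (enum_val j); rewrite /f !enum_valK.
Qed.

(* Adding the projection onto constants makes the Laplacian invertible and
   leaves it unchanged on their orthogonal complement. *)
Local Notation M := (L + #|G|%:R^-1 *: const_mx 1).

(** A vector killed by [M] is orthogonal to the constants, because [M] fixes the
    all-ones matrix; it is then killed by the Laplacian, so it is constant. *)
Lemma shifted_laplacian_unit : M \in unitmx.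
Proof.
have n0 : #|G|%:R != 0 :> R by rewrite pnatr_eq0 -lt0n order_gt0.
rewrite -row_free_unit -kermx_eq0; apply/eqP/row_matrixP=> i; rewrite row0.
move: (row i _) (row_sub i (kermx M)) => v /sub_kermxP vM.
have vJ : v *m (const_mx 1 : 'M_#|G|) = 0.
  have := congr1 (mulmx^~ (const_mx 1 : 'M_#|G|)) vM.
  rewrite -mulmxA mulmxDl laplacian_const add0r -scalemxAl const_mx1_sqr scalerA mulVf //.
  by rewrite scale1r mul0mx.
have Lv : L *m v^T = 0.
  apply: trmx_inj; rewrite trmx_mul trmxK laplacian_sym trmx0.
  by move: vM; rewrite mulmxDr -scalemxAr vJ scaler0 addr0.
apply/rowP=> k; rewrite mxE; apply: (mulfI n0); rewrite mulr0.
have /rowP/(_ k) := vJ; rewrite !mxE => <-.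
rewrite (eq_bigr (fun=> v 0 k)) => [|l _].
  by rewrite sumr_const card_ord mulr_natl.
by have := laplacian_ker_const Lv l k; rewrite !mxE mulr1.
Qed.

(** The shift turns the eigenvalue [0] of the constant vectors into [1]. *)
Lemma char_poly_shifted_laplacian :
  char_poly M * 'X = char_poly L * ('X - 1%:P).
Proof.
have n0 : #|G|%:R != 0 :> R by rewrite pnatr_eq0 -lt0n order_gt0.
pose u : 'cV[R]_#|G| := const_mx 1; pose v : 'rV[R]_#|G| := const_mx #|G|%:R^-1.
have uv : u *m v = #|G|%:R^-1 *: const_mx 1.
  by apply/matrixP=> i j; rewrite !mxE big_ord1 !mxE mul1r mulr1.
have vu : (v *m u) 0 0 = 1.
  rewrite mxE (eq_bigr (fun=> #|G|%:R^-1)) => [|k _]; last by rewrite !mxE mulr1.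
  by rewrite sumr_const card_ord -[_ *+ _]mulr_natr mulVf.
by rewrite -uv char_poly_rank1_update ?vu ?laplacian_const.
Qed.

(** The nonnegative list [mu] contains [0], so its last entry is [0]; the other
    entries together with [1] are the eigenvalues of the shifted matrix. In
    particular they are nonzero, since the shifted matrix is invertible. *)
Lemma trace_inv_shifted_laplacian mu : eigenvalue_list L mu ->
  \tr (invmx M) = 1 + \sum_(0 <= i < #|G|.-1) 1 / mu`_i.
Proof.
case=> mu_sorted pL; have pM := char_poly_shifted_laplacian.
have smu : size mu = #|G|.
  by apply/eqP; rewrite -eqSS -(size_prod_XsubC mu id) -pL size_char_poly.
have mu_ge0 a : a \in mu -> 0 <= a.
  by move=> amu; apply: laplacian_eigenvalue_ge0; rewrite pL root_prod_XsubC.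
have mu0 : 0 \in mu.
  have := congr1 (fun p => p.[0]) pM.
  rewrite !(hornerM, hornerX, hornerXsubC) mulr0 sub0r mulrN1 => /esym/eqP.
  by rewrite oppr_eq0 -rootE pL root_prod_XsubC.
case/lastP: mu mu_sorted pL smu mu_ge0 mu0 => // s a s_sorted pL smu s_ge0 s0.
have a0 : a = 0.
  apply: le_anti; rewrite s_ge0 ?mem_rcons ?mem_head // andbT.
  move: s0; rewrite mem_rcons inE => /predU1P[->//|s0].
  move: s_sorted; rewrite -cats1 sorted_pairwise; last exact: ge_trans.
  by rewrite pairwise_cat => /and3P[/allrelP/(_ 0 a s0 (mem_head _ _))].
have pM' : char_poly M = \prod_(x <- 1 :: s) ('X - x%:P).
  apply: (@mulIf _ 'X); first by rewrite polyX_eq0.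
  rewrite pM pL -cats1 big_cat big_seq1 big_cons a0 subr0 /=; ring.
rewrite (trace_invmx shifted_laplacian_unit pM') big_cons invr1; congr (_ + _).
move: smu; rewrite size_rcons => <- /=; rewrite (big_nth 0); apply: eq_big_nat => i /andP[_ si].
by rewrite nth_rcons si div1r.
Qed.

Definition dist_mx : 'M[R]_#|G| :=
  \matrix_(i, j) (dist (enum_val i) (enum_val j))%:R.

Lemma wiener_dist_mx : \tr (dist_mx *m const_mx 1) = (wiener G)%:R *+ 2.
Proof.
have -> : \tr (dist_mx *m const_mx 1) = (\sum_(x : G) \sum_(y : G) dist x y)%N%:R.
  rewrite natr_sum -sum_ord_vertex; apply: eq_bigr => i _.
  rewrite mxE natr_sum -sum_ord_vertex; apply: eq_bigr => j _.
  by rewrite !mxE mulr1.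
rewrite -[RHS]mulr_natr -natrM; congr _%:R; rewrite muln2 -addnn.
have {2}-> : wiener G =
    (\sum_(x : G) \sum_(y : G | enum_rank y < enum_rank x) dist x y)%N.
  rewrite /wiener (exchange_big_dep xpredT) //=.
  by apply: eq_bigr => x _; apply: eq_bigr => y _; exact: dist_sym.
rewrite /wiener -big_split; apply: eq_bigr => x _ /=.
rewrite (bigID (fun y => (enum_rank x < enum_rank y)%N)) /=; congr (_ + _)%N.
rewrite (bigD1 x) ?ltnn //= dist_xx // add0n; apply: eq_bigl => y.
by rewrite -leqNgt ltn_neqAle -(inj_eq enum_rank_inj) andbC.
Qed.

Variable b : nat.
Hypothesis G_blocks : forall H : subgraph G, block H -> clique_of_order b H.

(** For [x != y], exactly one neighbour of [x] is closer to [y], the [b - 2]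
    others in the same block are equidistant, and the remaining ones are
    farther by one: the sum is [1 - (degree x - (b - 1))]. *)
Lemma sum_dist_neighbours (x y : G) :
  \sum_z (adj x z)%:R * ((dist x y)%:R - (dist z y)%:R) =
  b%:R * (x != y)%:R - (degree x)%:R :> R.
Proof.
have [->|xy] := eqVneq x y.
  rewrite mulr0 sub0r natr_degree -sumrN; apply: eq_bigr => z _.
  case yz: (adj y z); rewrite ?mul0r ?oppr0 // dist_xx //.
  have zy : (0 < dist z y)%N by rewrite dist_gt0 // eq_sym adj_neq.
  have : (dist y z <= (dist z z).+1)%N by exact: dist_adj.
  rewrite dist_xx dist_sym // => ?.
  have -> : dist z y = 1%N by lia.
  by rewrite mul1r sub0r.
have [z0 xz0 dz0] := closer_neighbour G_connected xy.
(* Closer, equidistant and farther neighbours contribute 1, 0 and -1. *)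
rewrite (eq_bigr (fun z => 2 * (z == z0)%:R + (z \in common x z0)%:R
    - (adj x z)%:R)) => [|z _]; last first.
  case xz: (adj x z); last first.
    rewrite inE xz mul0r; case: eqVneq => [ezz|_]; first by rewrite ezz xz0 in xz.
    by rewrite mulr0 addr0 subr0.
  have := equidistant_common G_connected G_blocks xz0 dz0 xz.
  have [->|zz0] := eqVneq z z0.
    rewrite inE adj_irr andbF dz0 -natr1 => _ /=; ring.
  case: (z \in _) => /eqP dz; first by rewrite dz /=; ring.
  have dxz := dist_adj G_connected y xz.
  have dzx : (dist z y <= (dist x y).+1)%N by apply: dist_adj; rewrite // adj_sym.
  have nz : dist x y <> (dist z y).+1.
    by move/(closer_unique G_connected G_blocks xz0 xz dz0)/eqP; apply/negP.
  have -> : dist z y = (dist x y).+1 by lia.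
  by rewrite -natr1 /=; ring.
rewrite sumrB big_split /= -natr_degree; congr (_ - _).
rewrite -mulr_sumr (bigD1 z0) //= eqxx big1 => [|z /negPf->//].
have -> : \sum_z (z \in common x z0)%:R = #|common x z0|%:R :> R.
  rewrite -sum1_card natr_sum [RHS]big_mkcond; apply: eq_bigr => z _.
  by case: (z \in _).
by rewrite (card_common G_blocks xz0) -addn2 natrD /=; ring.
Qed.

(** By [sum_dist_neighbours] the rows of [L D + b I] are constant, and [L] kills
    constant rows from the right. *)
Lemma laplacian_dist : L *m dist_mx *m L = - b%:R *: L.
Proof.
have E : L *m dist_mx = (\col_i (b%:R - (degree (enum_val i))%:R)) *m const_mx 1 - b%:R%:M.
  apply/matrixP=> i j; rewrite laplacian_mulE !mxE big_ord1 !mxE mulr1.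
  set x := enum_val i; set y := enum_val j.
  have := sum_dist_neighbours x y; rewrite -sum_ord_vertex.
  rewrite (inj_eq enum_val_inj) => e.
  transitivity (b%:R * (i != j)%:R - (degree x)%:R : R).
    by rewrite -e; apply: eq_bigr => k _; rewrite !mxE.
  by case: eqVneq => _ /=; rewrite ?mulr1n ?mulr0n; ring.
by rewrite E mulmxBl -mulmxA const_laplacian mulmx0 sub0r mul_scalar_mx scaleNr.
Qed.

End Laplacian.

Theorem theorem4 (R : rcfType) (G : sgraph) (n b : nat) (mu : seq R)
    (G_connected : connected_graph G)
    (G_order : #|G| = n)
    (G_blocks : forall H : subgraph G, block H -> clique_of_order b H)
    (mu_spectrum : eigenvalue_list (laplacian R G) mu) :
  (wiener G)%:R = (n * b)%:R / 2 * \sum_(0 <= i < n.-1) 1 / mu`_i.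
Proof.
subst n.
have trD : \tr (dist_mx R G) = 0.
  by rewrite /mxtrace big1 // => i _; rewrite mxE dist_xx.
have := sum_entries_of_sandwich (order_gt0 G_connected) (shifted_laplacian_unit R G_connected)
  (laplacian_const R G _) (const_laplacian R G _) (laplacian_dist R G_connected G_blocks) trD.
rewrite wiener_dist_mx // (trace_inv_shifted_laplacian G_connected mu_spectrum).
rewrite natrM -mulr_natr => E.
apply: (@mulIf _ 2); first by rewrite pnatr_eq0.
by rewrite E; field.
Qed.
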